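(* Let $M_1=\mathbb R$ with coordinate $x$ and $M_2=\mathbb R^q$, $q>1$, with coordinates $(y_1,\dots,y_q)$, equipped with pseudo-Riemannian metrics $g_1,g_2$. Consider the Lyra twisted warped product $M_1\times_fM_2$ with scale $\varphi$, where $k=\ln f$ and $\sigma=\ln\varphi$ are given by $$k=xy_1,\qquad \sigma=s(x),$$ with $s\in C^\infty(\mathbb R)$. Then no Lyra almost Ricci--Bourguignon soliton $(g_L,Z,\lambda,\rho)$ with projectable potential field $Z$ exists on any (nonempty open) product neighborhood $W_1\times W_2\subset M_1\times M_2$.
   Context: Lyra twisted warped product: $M=M_1\times M_2$ with $g=g_1\oplus f^2g_2$ and Lyra metric $g_L=\varphi^2g=e^{2\sigma}g$, $f,\varphi$ smooth and positive. $\operatorname{Ric}^L,R^L$ are the Ricci tensor and scalar curvature of $g_L$. A Lyra almost Ricci--Bourguignon soliton on an open set $W$ is $(g_L,Z,\lambda,\rho)$ with $Z$ a smooth vector field on $W$, $\lambda\in C^\infty(W)$, $\rho\in\mathbb R$, satisfying $\operatorname{Ric}^L+\frac12\mathcal L_Zg_L=(\lambda+\rho R^L)g_L$. $Z$ is projectable if $Z=Z_1+Z_2$ with $Z_1,Z_2$ canonical lifts of vector fields on the first and second factors. *)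

(* Defs.v *)
From HB Require Import structures.
From mathcomp Require Import all_boot all_order all_algebra.
From mathcomp Require Import all_classical all_reals all_analysis.

Set Implicit Arguments.
Unset Strict Implicit.
Unset Printing Implicit Defensive.

Import Order.TTheory GRing.Theory Num.Theory.
Import numFieldNormedType.Exports.

Local Open Scope classical_set_scope.
Local Open Scope ring_scope.

(* C^oo on A, for A open and V finite-dimensional: every iterated directional
   derivative of f (including f itself) is Frechet differentiable on A.
   Derivatives at points of the open set A only see f near these points, so
   the values of f outside A are irrelevant. *)
Definition smooth_on (R : realType) (V : normedModType R)
    (A : set V) (f : V -> R) : Prop :=
  forall (vs : seq V) (x : V), A x ->
    differentiable (foldr (fun v (h : V -> R) => 'D_v h : V -> R) f vs) x.

(* Vector fields and 2-tensors on R^n are given by their components in the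
   frame of coordinate fields d_0, ..., d_(n-1); Z p 0 i is the d_i-component
   of the vector field Z at p, and g p i j = g(d_i, d_j) at p. *)

Definition vector_field_on (R : realType) (n : nat)
    (A : set 'rV[R]_n) (Z : 'rV[R]_n -> 'rV[R]_n) : Prop :=
  forall i, smooth_on A (fun p => Z p 0 i).

(* The index of a nondegenerate symmetric smooth g is automatically constant,
   since R^n is connected. *)
Definition pseudo_riemannian_metric (R : realType) (n : nat)
    (g : 'rV[R]_n -> 'M[R]_n) : Prop :=
  [/\ forall i j, smooth_on setT (fun p => g p i j),
      forall p, (g p)^T = g p
    & forall p, g p \in unitmx].

Section Curvature.
Variables (R : realType) (n : nat).
Implicit Types (g : 'rV[R]_n -> 'M[R]_n) (Z : 'rV[R]_n -> 'rV[R]_n).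

Definition partial (i : 'I_n) (h : 'rV[R]_n -> R) (p : 'rV[R]_n) : R :=
  'D_(delta_mx 0 i : 'rV[R]_n) h p.

(* Levi-Civita connection: nabla_(d_i) d_j = \sum_k christoffel g k i j d_k *)
Definition christoffel g (k i j : 'I_n) (p : 'rV[R]_n) : R :=
  2^-1 * \sum_l invmx (g p) k l *
    (partial i (fun x => g x j l) p + partial j (fun x => g x i l) p
     - partial l (fun x => g x i j) p).

(* R(d_i, d_j) d_k = \sum_l riemann g l k i j d_l, with the convention
   R(X, Y) = [nabla_X, nabla_Y] - nabla_[X, Y] *)
Definition riemann g (l k i j : 'I_n) (p : 'rV[R]_n) : R :=
  partial i (christoffel g l j k) p - partial j (christoffel g l i k) p
  + \sum_m (christoffel g l i m p * christoffel g m j k p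
            - christoffel g l j m p * christoffel g m i k p).

(* Ric(Y, Z) = trace of X |-> R(X, Y) Z *)
Definition ricci g (p : 'rV[R]_n) : 'M[R]_n :=
  \matrix_(j, k) \sum_i riemann g i k i j p.

Definition scalar_curvature g (p : 'rV[R]_n) : R :=
  \sum_i \sum_j invmx (g p) i j * ricci g p i j.

(* (L_Z g)(d_i, d_j) = Z (g(d_i, d_j)) - g([Z, d_i], d_j) - g(d_i, [Z, d_j]),
   where [Z, d_i] = - \sum_k (d_i Z^k) d_k *)
Definition lie_derivative Z g (p : 'rV[R]_n) : 'M[R]_n :=
  \matrix_(i, j) \sum_k
    (Z p 0 k * partial k (fun x => g x i j) p
     + partial i (fun x => Z x 0 k) p * g p k j
     + partial j (fun x => Z x 0 k) p * g p i k).

Definition almost_ricci_bourguignon_soliton (W : set 'rV[R]_n) g Z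
    (lambda : 'rV[R]_n -> R) (rho : R) : Prop :=
  [/\ vector_field_on W Z,
      smooth_on W lambda
    & forall p, W p ->
        ricci g p + 2^-1 *: lie_derivative Z g p
        = (lambda p + rho * scalar_curvature g p) *: g p].

End Curvature.

Section TwistedProduct.
Variables (R : realType) (m q : nat).

(* R^m x R^q is identified with R^(m + q): the projections on the factors are
   lsubmx and rsubmx. *)

Definition product_set (W1 : set 'rV[R]_m) (W2 : set 'rV[R]_q) :
    set 'rV[R]_(m + q) :=
  [set p | W1 (lsubmx p) /\ W2 (rsubmx p)].

Definition twisted_metric (f : 'rV[R]_(m + q) -> R)
    (g1 : 'rV[R]_m -> 'M[R]_m) (g2 : 'rV[R]_q -> 'M[R]_q)
    (p : 'rV[R]_(m + q)) : 'M[R]_(m + q) :=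
  block_mx (g1 (lsubmx p)) 0 0 (f p ^+ 2 *: g2 (rsubmx p)).

Definition lyra_metric (phi f : 'rV[R]_(m + q) -> R)
    (g1 : 'rV[R]_m -> 'M[R]_m) (g2 : 'rV[R]_q -> 'M[R]_q)
    (p : 'rV[R]_(m + q)) : 'M[R]_(m + q) :=
  phi p ^+ 2 *: twisted_metric f g1 g2 p.

Definition projectable (W1 : set 'rV[R]_m) (W2 : set 'rV[R]_q)
    (Z : 'rV[R]_(m + q) -> 'rV[R]_(m + q)) : Prop :=
  exists (Z1 : 'rV[R]_m -> 'rV[R]_m) (Z2 : 'rV[R]_q -> 'rV[R]_q),
    [/\ vector_field_on W1 Z1,
        vector_field_on W2 Z2
      & forall p, product_set W1 W2 p ->
          Z p = row_mx (Z1 (lsubmx p)) 0 + row_mx 0 (Z2 (rsubmx p))].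

End TwistedProduct.

(* Main.v *)
(* For a twisted product metric g1(x) + e^{2u} g2(y), the mixed Ricci components
   are (1 - q) d_b d_a u, whereas the mixed components of L_Z g vanish when Z is
   projectable. A soliton therefore forces d_b d_a u = 0. Because sigma depends
   on x only, g_L is such a metric with u = s(x) + x y_1, for which
   d_(y_1) d_x u = 1. *)

Require Import Defs.
From HB Require Import structures.
From mathcomp Require Import all_boot all_order all_algebra.
From mathcomp Require Import all_classical all_reals all_analysis.
From mathcomp Require Import ring.

Import Order.TTheory GRing.Theory Num.Theory.
Import numFieldNormedType.Exports.

Local Open Scope classical_set_scope.
Local Open Scope ring_scope.

(** * Directional derivatives as one-variable derivatives along lines *)

(** Both [derive] and [derivable] are read off this quotient, so equality of the quotients as
    functions transfers values and existence of derivatives at once. *)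
Lemma difference_quotient_line (R : realType) (V : normedModType R) (h : V -> R)
    (p v : V) :
  (fun k : R => k^-1 *: ((h \o shift p) (k *: v) - h p))
  = (fun k : R => k^-1 *: (((fun t : R => h (t *: v + p)) \o shift 0) (k *: 1)
                          - h (0 *: v + p))).
Proof.
apply/funext => k /=; have -> : k *: (1 : R) = k by exact: mulr1.
by rewrite addr0 scale0r add0r.
Qed.

Lemma derive_line (R : realType) (V : normedModType R) (h : V -> R) (p v : V) :
  'D_v h p = 'D_1 (fun t : R => h (t *: v + p)) 0.
Proof. by rewrite /derive difference_quotient_line. Qed.

Lemma derivable_line (R : realType) (V : normedModType R) (h : V -> R)
    (p v : V) :
  derivable h p v -> derivable (fun t : R => h (t *: v + p)) 0 1.
Proof. by rewrite /derivable difference_quotient_line. Qed.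

(** Constancy is asked only near [0] because a projectable field splits only over [W1] and [W2], not
    on the whole space. *)
Lemma derive_near_line_cst (R : realType) (V : normedModType R) (h : V -> R)
    (p v : V) :
  (\forall t \near (0 : R), h (t *: v + p) = h p) -> 'D_v h p = 0.
Proof.
move=> hc; rewrite derive_line.
transitivity ('D_1 (cst (h p) : R -> R) (0 : R)); last exact: derive_cst.
exact: (@near_eq_derive R R R (fun t => h (t *: v + p)) (cst (h p)) 0 1 hc).
Qed.

Lemma open_line_near (R : realType) (V : normedModType R) (W : set V)
    (p v : V) :
  open W -> W p -> \forall t \near (0 : R), W (t *: v + p).
Proof.
move=> oW Wp.
have c : {for (0 : R), continuous (fun t : R => t *: v + p)}.
  by apply: cvgD; [apply: cvgZ; [exact: cvg_id|exact: cvg_cst] | exact: cvg_cst].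
by apply: c; rewrite scale0r add0r; exact: open_nbhs_nbhs.
Qed.

(** Along the line [H] is a constant factor, so only the chain rule for e^(2u) acts. This is meant
    for the block e^(2u) g2 differentiated in a direction of the first factor. *)
Lemma derive_expR_sqrM (R : realType) (V : normedModType R) (u H : V -> R)
    (p v : V) :
  derivable u p v -> (forall t : R, H (t *: v + p) = H p) ->
  'D_v (fun x => expR (u x) ^+ 2 * H x) p
  = 2 * 'D_v u p * (expR (u p) ^+ 2 * H p).
Proof.
move=> du Hc; rewrite derive_line (derive_line _ _ u).
set w := fun t : R => u (t *: v + p).
have dw : derivable w 0 1 := derivable_line _ _ _ _ _ du.
have w0 : w 0 = u p by rewrite /w scale0r add0r.
have -> : (fun t : R => expR (u (t *: v + p)) ^+ 2 * H (t *: v + p))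
          = H p \*: ((expR \o w) ^+ 2).
  by apply/funext => t /=; rewrite Hc mulrC.
have De : is_derive (0 : R) 1 (expR \o w) (expR (w 0) * 'D_1 w 0).
  by apply: is_derive1_comp; apply: derivableP.
have := @is_deriveZ _ _ _ _ (H p) _ _ _ (is_deriveX 2 De).
by move=> [_ ->]; rewrite /= w0 /GRing.scale /=; ring.
Qed.

(** * Coordinate lines of the product and their projections *)

Section CoordinateLines.
Variables (R : realType) (m q : nat).
Implicit Types (p : 'rV[R]_(m + q)) (t : R) (a : 'I_m) (b : 'I_q).

Lemma lsubmx_line_lshift t a p :
  lsubmx (t *: delta_mx 0 (lshift q a) + p) = t *: delta_mx 0 a + lsubmx p.
Proof. by apply/rowP => j; rewrite !mxE !eqxx /= (inj_eq (@lshift_inj _ _)). Qed.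

Lemma lsubmx_line_rshift t b p :
  lsubmx (t *: delta_mx 0 (rshift m b) + p) = lsubmx p.
Proof. by apply/rowP => j; rewrite !mxE !eqxx /= eq_lrshift mulr0 add0r. Qed.

Lemma rsubmx_line_lshift t a p :
  rsubmx (t *: delta_mx 0 (lshift q a) + p) = rsubmx p.
Proof. by apply/rowP => j; rewrite !mxE !eqxx /= eq_rlshift mulr0 add0r. Qed.

Lemma rsubmx_line_rshift t b p :
  rsubmx (t *: delta_mx 0 (rshift m b) + p) = t *: delta_mx 0 b + rsubmx p.
Proof. by apply/rowP => j; rewrite !mxE !eqxx /= (inj_eq (@rshift_inj _ _)). Qed.

Lemma partial_lsubmx_rshift (h : 'rV[R]_m -> R) b p :
  partial (rshift m b) (fun x => h (lsubmx x)) p = 0.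
Proof.
by apply: derive_near_line_cst; near=> t; rewrite lsubmx_line_rshift.
Unshelve. all: by end_near. Qed.

Lemma partial_lsubmx_lshift (h : 'rV[R]_m -> R) a p :
  partial (lshift q a) (fun x => h (lsubmx x)) p = partial a h (lsubmx p).
Proof.
rewrite /partial derive_line [RHS]derive_line.
by under eq_fun do rewrite lsubmx_line_lshift.
Qed.

End CoordinateLines.

Lemma partial_cst (R : realType) (n : nat) (i : 'I_n) (c : R) (p : 'rV[R]_n) :
  partial i (fun=> c) p = 0.
Proof. exact: derive_cst. Qed.

Lemma christoffel_sym (R : realType) (n : nat) (g : 'rV[R]_n -> 'M[R]_n)
    (k i j : 'I_n) (p : 'rV[R]_n) :
  (forall x, (g x)^T = g x) -> christoffel g k i j p = christoffel g k j i p.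
Proof.
move=> gT; congr (_ * _); apply: eq_bigr => l _; congr (_ * _).
have -> : (fun x => g x i j) = (fun x => g x j i).
  by apply/funext => x; rewrite -[in LHS]gT mxE.
by rewrite [X in X - _]addrC.
Qed.

(** * Block structure and the mixed Lie derivative *)

Section TwistedMetricBlocks.
Variables (R : realType) (m q : nat) (f : 'rV[R]_(m + q) -> R).
Variables (g1 : 'rV[R]_m -> 'M[R]_m) (g2 : 'rV[R]_q -> 'M[R]_q).

Local Notation G := (twisted_metric f g1 g2).
Implicit Types (p : 'rV[R]_(m + q)) (a : 'I_m) (b : 'I_q).

Lemma twisted_metric_lr p a b : G p (lshift q a) (rshift m b) = 0.
Proof. by rewrite block_mxEur mxE. Qed.

Lemma twisted_metric_rl p a b : G p (rshift m b) (lshift q a) = 0.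
Proof. by rewrite block_mxEdl mxE. Qed.

Lemma partial_twisted_metric_lr i p a b :
  partial i (fun x => G x (lshift q a) (rshift m b)) p = 0.
Proof.
by under eq_fun do rewrite twisted_metric_lr; rewrite partial_cst.
Qed.

Lemma partial_twisted_metric_rl i p a b :
  partial i (fun x => G x (rshift m b) (lshift q a)) p = 0.
Proof.
by under eq_fun do rewrite twisted_metric_rl; rewrite partial_cst.
Qed.

(** The mixed entries of [G] are identically zero, so the only terms left carry d_b of a
    first-factor component of [Z] or d_a of a second-factor component. Projectability makes both
    vanish. *)
Lemma lie_derivative_twisted_metric_rl (W1 : set 'rV[R]_m) (W2 : set 'rV[R]_q)
    (Z : 'rV[R]_(m + q) -> 'rV[R]_(m + q)) p a b :
  open W1 -> open W2 -> projectable W1 W2 Z -> product_set W1 W2 p ->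
  lie_derivative Z G p (rshift m b) (lshift q a) = 0.
Proof.
move=> oW1 oW2 [Z1 [Z2 [_ _ ZE]]] pW; have [pW1 pW2] := pW.
have ZEl z k : product_set W1 W2 z -> Z z 0 (lshift q k) = Z1 (lsubmx z) 0 k.
  by move=> /ZE ->; rewrite mxE !row_mxEl mxE addr0.
have ZEr z k : product_set W1 W2 z -> Z z 0 (rshift m k) = Z2 (rsubmx z) 0 k.
  by move=> /ZE ->; rewrite mxE !row_mxEr mxE add0r.
rewrite mxE big_split_ord /= !big1 ?addr0 // => k _.
  rewrite partial_twisted_metric_rl twisted_metric_rl !mulr0 !add0r.
  rewrite [partial _ _ _]derive_near_line_cst ?mul0r //.
  near=> t; rewrite !ZEr // => [|]; last first.
    split; rewrite ?lsubmx_line_lshift ?rsubmx_line_lshift //.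
    by near: t; exact: open_line_near.
  by rewrite rsubmx_line_lshift.
rewrite partial_twisted_metric_rl twisted_metric_rl !mulr0 add0r addr0.
rewrite [partial _ _ _]derive_near_line_cst ?mul0r //.
near=> t; rewrite !ZEl // => [|]; last first.
  split; rewrite ?lsubmx_line_rshift ?rsubmx_line_rshift //.
  by near: t; exact: open_line_near.
by rewrite lsubmx_line_rshift.
Unshelve. all: by end_near. Qed.

End TwistedMetricBlocks.

(** * Christoffel symbols and mixed Ricci components of g1 + e^(2u) g2 *)

Section TwistedMetric.
Variables (R : realType) (m q : nat) (u : 'rV[R]_(m + q) -> R).
Variables (g1 : 'rV[R]_m -> 'M[R]_m) (g2 : 'rV[R]_q -> 'M[R]_q).
Hypothesis u_derivable : forall p v, derivable u p v.
Hypothesis g1_unit : forall x, g1 x \in unitmx.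
Hypothesis g2_unit : forall y, g2 y \in unitmx.
Hypothesis g1_sym : forall x, (g1 x)^T = g1 x.
Hypothesis g2_sym : forall y, (g2 y)^T = g2 y.

Local Notation G := (twisted_metric (expR \o u) g1 g2).
Implicit Types (p : 'rV[R]_(m + q)) (a e : 'I_m) (b c : 'I_q).

Lemma twisted_metric_sym p : (G p)^T = G p.
Proof. by rewrite tr_block_mx linearZ /= g1_sym g2_sym !trmx0. Qed.

Lemma twisted_metric_unit p : G p \in unitmx.
Proof.
rewrite unitmxE det_ublock unitrM -!unitmxE g1_unit unitmxZ ?g2_unit //.
by rewrite unitfE expf_neq0 // gt_eqF // expR_gt0.
Qed.

Lemma invmx_twisted_metric p :
  invmx (G p) = block_mx (invmx (g1 (lsubmx p))) 0
                  0 (invmx (expR (u p) ^+ 2 *: g2 (rsubmx p))).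
Proof. by rewrite invmx_block_diag // twisted_metric_unit. Qed.

Lemma invmx_twisted_metric_lr p a b :
  invmx (G p) (lshift q a) (rshift m b) = 0.
Proof. by rewrite invmx_twisted_metric block_mxEur mxE. Qed.

Lemma invmx_twisted_metric_rl p a b :
  invmx (G p) (rshift m b) (lshift q a) = 0.
Proof. by rewrite invmx_twisted_metric block_mxEdl mxE. Qed.

Lemma partial_lshift_twisted_metric_ll p a e e' :
  partial (lshift q a) (fun x => G x (lshift q e) (lshift q e')) p
  = partial a (fun x => g1 x e e') (lsubmx p).
Proof.
under eq_fun do rewrite block_mxEul.
exact: (partial_lsubmx_lshift _ _ _ (fun x => g1 x e e')).
Qed.

Lemma partial_rshift_twisted_metric_ll p b e e' :
  partial (rshift m b) (fun x => G x (lshift q e) (lshift q e')) p = 0.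
Proof.
under eq_fun do rewrite block_mxEul.
exact: (partial_lsubmx_rshift _ _ _ (fun x => g1 x e e')).
Qed.

Lemma partial_lshift_twisted_metric_rr p a b c :
  partial (lshift q a) (fun x => G x (rshift m b) (rshift m c)) p
  = 2 * partial (lshift q a) u p * G p (rshift m b) (rshift m c).
Proof.
under eq_fun do rewrite block_mxEdr mxE.
rewrite block_mxEdr mxE /partial.
apply: (@derive_expR_sqrM _ _ _ (fun x => g2 (rsubmx x) b c)) => // t.
by rewrite rsubmx_line_lshift.
Qed.

Lemma christoffel_l_lr p a e b :
  christoffel G (lshift q e) (lshift q a) (rshift m b) p = 0.
Proof.
rewrite /christoffel big_split_ord /= !big1 ?addr0 ?mulr0 // => l _.
  by rewrite invmx_twisted_metric_lr mul0r.
by rewrite partial_twisted_metric_rl partial_rshift_twisted_metric_ll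
  partial_twisted_metric_lr !addr0 subr0 mulr0.
Qed.

(** Geometrically, the slices M_1 x {y} are totally geodesic, since the first block does not depend
    on y. *)
Lemma christoffel_r_ll p a e c :
  christoffel G (rshift m c) (lshift q a) (lshift q e) p = 0.
Proof.
rewrite /christoffel big_split_ord /= !big1 ?addr0 ?mulr0 // => l _.
  by rewrite !partial_twisted_metric_lr partial_rshift_twisted_metric_ll
    !addr0 subr0 mulr0.
by rewrite invmx_twisted_metric_rl mul0r.
Qed.

(** Only d_a of the block e^(2u) g2 survives. It is 2 d_a u times that block: the 2 cancels the one
    half of the Koszul formula, and the block cancels against its inverse. *)
Lemma christoffel_r_lr p a b c :
  christoffel G (rshift m c) (lshift q a) (rshift m b) p
  = (c == b)%:R * partial (lshift q a) u p.
Proof.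
rewrite /christoffel big_split_ord /= big1 ?add0r; last first.
  by move=> l _; rewrite invmx_twisted_metric_rl mul0r.
under eq_bigr => l _.
  rewrite partial_lshift_twisted_metric_rr 2!partial_twisted_metric_lr.
  rewrite addr0 subr0 mulrCA.
  have -> : G p (rshift m b) (rshift m l) = G p (rshift m l) (rshift m b).
    by rewrite -[in LHS]twisted_metric_sym mxE.
  over.
rewrite -mulr_sumr mulrA mulrA mulVf ?pnatr_eq0 // mul1r mulrC.
congr (_ * _).
(* The Kronecker delta is the second diagonal block of G^-1 G = 1, to which first-factor indices
   contribute nothing. *)
have /matrixP/(_ (rshift m c) (rshift m b)) := mulVmx (twisted_metric_unit p).
rewrite !mxE (inj_eq (@rshift_inj _ _)) => <-.
rewrite [RHS]big_split_ord /= [X in _ = X + _]big1 ?add0r // => l _.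
by rewrite invmx_twisted_metric_rl mul0r.
Qed.

Lemma christoffel_l_ll p a e e' :
  christoffel G (lshift q e') (lshift q a) (lshift q e) p
  = christoffel g1 e' a e (lsubmx p).
Proof.
rewrite /christoffel big_split_ord /= [X in _ + X]big1 ?addr0; last first.
  by move=> l _; rewrite invmx_twisted_metric_lr mul0r.
congr (_ * _); apply: eq_bigr => l _.
by rewrite invmx_twisted_metric block_mxEul !partial_lshift_twisted_metric_ll.
Qed.

(** In the trace, d_i Gamma^i_(ba) contributes only for i = b, while d_b Gamma^i_(ia) contributes
    once for each of the q second-factor indices. The quadratic terms cancel. *)
Lemma ricci_twisted_metric_rl p a b :
  ricci G p (rshift m b) (lshift q a)
  = (1 - q%:R) * partial (rshift m b) (partial (lshift q a) u) p.
Proof.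
have Gs := fun k i j x => christoffel_sym _ _ G k i j x twisted_metric_sym.
set D := partial (rshift m b) _ p.
have Cr c x : christoffel G (rshift m c) (rshift m b) (lshift q a) x
  = (c == b)%:R * partial (lshift q a) u x.
  by rewrite Gs christoffel_r_lr.
have Cl e x : christoffel G (lshift q e) (rshift m b) (lshift q a) x = 0.
  by rewrite Gs christoffel_l_lr.
rewrite mxE /riemann big_split /= sumrB.
(* The three summands match the two derivative traces and the quadratic part, treated in this order
   below. *)
transitivity (D - q%:R * D + 0); last by rewrite addr0 mulrBl mul1r.
congr (_ - _ + _).
- rewrite big_split_ord /= big1 ?add0r => [|e _]; last first.
    by rewrite (_ : christoffel _ _ _ _ = fun=> 0) ?partial_cst //; apply/funext.
  rewrite (bigD1 b) //= big1 ?addr0 => [|c /negPf cb].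
    by congr (partial _ _ p); apply/funext => x; rewrite Cr eqxx mul1r.
  rewrite (_ : christoffel _ _ _ _ = fun=> 0) ?partial_cst //.
  by apply/funext => x; rewrite Cr cb mul0r.
- rewrite big_split_ord /= big1 ?add0r => [|e _]; last first.
    (* For first-factor indices the symbol is that of [g1], a function of x alone, which d_b
       kills. *)
    rewrite (_ : christoffel _ _ _ _ =
      fun x => christoffel g1 e e a (lsubmx x)) ?partial_lsubmx_rshift //.
    by apply/funext => x; rewrite christoffel_l_ll.
  rewrite mulr_natl -[in RHS](card_ord q) -sumr_const; apply: eq_bigr => c _.
  congr (partial _ _ p); apply/funext => x.
  by rewrite Gs christoffel_r_lr eqxx mul1r.
- under eq_bigr do rewrite sumrB; rewrite sumrB.
  apply/eqP; rewrite subr_eq0; apply/eqP.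
  set ua := partial (lshift q a) u p.
  (* Both quadratic sums equal d_a u times the contracted symbol Gamma^i_(ib). *)
  transitivity (\sum_i christoffel G i i (rshift m b) p * ua).
    apply: eq_bigr => i _; rewrite big_split_ord /= big1 ?add0r => [|e _].
      rewrite (bigD1 b) //= big1 ?addr0 => [|c /negPf cb].
        by rewrite Cr eqxx mul1r.
      by rewrite Cr cb mul0r mulr0.
    by rewrite Cl mulr0.
  rewrite big_split_ord /= [RHS]big_split_ord /=; congr (_ + _).
    apply: eq_bigr => e _; rewrite christoffel_l_lr mul0r.
    rewrite big_split_ord /= !big1 ?addr0 // => l _.
      by rewrite christoffel_r_ll mulr0.
    by rewrite Gs christoffel_l_lr mul0r.
  apply: eq_bigr => c _.
  rewrite big_split_ord /= big1 ?add0r => [|e _]; last first.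
    by rewrite [X in _ * X]Gs christoffel_l_lr mulr0.
  rewrite (bigD1 c) //= big1 ?addr0 => [|l lc].
    by rewrite [X in _ = _ * X]Gs christoffel_r_lr eqxx mul1r Gs.
  by rewrite [X in _ * X]Gs christoffel_r_lr (negPf lc) mul0r mulr0.
Qed.

End TwistedMetric.

(** * The case k = x y_1, sigma = s(x) *)

Theorem proposition6p1 (R : realType) (q : nat) (hq : (1 < q)%N)
  (g1 : 'rV[R]_1 -> 'M[R]_1) (g2 : 'rV[R]_q -> 'M[R]_q)
  (hg1 : pseudo_riemannian_metric g1) (hg2 : pseudo_riemannian_metric g2)
  (f phi : 'rV[R]_(1 + q) -> R) (s : R -> R)
  (hf : smooth_on setT f) (f_gt0 : forall p, 0 < f p)
  (hphi : smooth_on setT phi) (phi_gt0 : forall p, 0 < phi p)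
  (hs : smooth_on setT s)
  (* k = ln f = x y_1, where y_1 is the first coordinate of M_2 *)
  (hk : forall p, ln (f p) = lsubmx p 0 0 * rsubmx p 0 (Ordinal (ltnW hq)))
  (hsigma : forall p, ln (phi p) = s (lsubmx p 0 0))
  (W1 : set 'rV[R]_1) (W2 : set 'rV[R]_q)
  (hW1 : open W1) (hW2 : open W2) (W1_neq0 : W1 !=set0) (W2_neq0 : W2 !=set0) :
  ~ exists (Z : 'rV[R]_(1 + q) -> 'rV[R]_(1 + q))
      (lambda : 'rV[R]_(1 + q) -> R) (rho : R),
      projectable W1 W2 Z /\
      almost_ricci_bourguignon_soliton (product_set W1 W2)
        (lyra_metric phi f g1 g2) Z lambda rho.
Proof.
move=> [Z [lambda [rho [Zproj [_ _ soliton]]]]].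
have [x xW1] := W1_neq0; have [y yW2] := W2_neq0.
set i1 := Ordinal (ltnW hq) in hk.
pose p : 'rV[R]_(1 + q) := row_mx x y.
have pW : product_set W1 W2 p by split; rewrite ?row_mxKl ?row_mxKr.
(* Since phi = e^(s(x)) depends on x only, phi^2 is absorbed into the first factor; on the second
   block phi^2 f^2 becomes e^(2u). *)
pose h1 (x : 'rV[R]_1) := expR (s (x 0 0)) ^+ 2 *: g1 x.
pose u (z : 'rV[R]_(1 + q)) :=
  s (z 0 (lshift q 0)) + z 0 (lshift q 0) * z 0 (rshift 1 i1).
have GE : lyra_metric phi f g1 g2 = twisted_metric (expR \o u) h1 g2.
  apply/funext => z; rewrite /lyra_metric /twisted_metric scale_block_mx.
  rewrite !scaler0 scalerA -exprMn /h1 /=.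
  have -> : u z = ln (phi z) + ln (f z) by rewrite hsigma hk /u !mxE.
  by rewrite -hsigma expRD !lnK ?posrE.
(* The empty list of directions in [smooth_on] gives differentiability of [s] itself. *)
have ds t : derivable s t 1 by apply: diff_derivable; exact: (hs [::] t I).
have du z v : derivable u z v.
  apply: diff_derivable; apply: differentiableD.
    apply: differentiable_comp; first exact: differentiable_coord.
    exact: (hs [::] _ I).
  by apply: differentiableM; exact: differentiable_coord.
have dshift c : is_derive (0 : R) 1 (shift c) 1 by apply: is_derive_shift.
have pu z : partial (lshift q 0) u z
    = 'D_1 s (z 0 (lshift q 0)) + z 0 (rshift 1 i1).
  rewrite /partial derive_line.
  set a := z 0 (lshift _ _); set b := z 0 (rshift _ _).
  (* On the x-line through [z], u is t |-> s(t + a) + b (t + a). *)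
  rewrite (_ : (fun t : R => _) = (s \o shift a) + b \*: shift a); last first.
    apply/funext => t; rewrite /u !mxE !eqxx eq_rlshift /= mulr1 mulr0 add0r.
    by congr (_ + _); exact: mulrC.
  have Ds : is_derive (0 : R) 1 (s \o shift a) ('D_1 s a * 1).
    apply: is_derive1_comp; rewrite /= add0r; exact: derivableP.
  have [_ ->] := is_deriveD Ds (is_deriveZ b (dshift a)).
  by rewrite mulr1 /GRing.scale /= mulr1.
have ppu : partial (rshift 1 i1) (partial (lshift q 0) u) p = 1.
  rewrite (_ : partial (lshift q 0) u = fun z =>
    'D_1 s (z 0 (lshift q 0)) + z 0 (rshift 1 i1)); last exact/funext.
  (* On a y_1-line x is fixed, so d_x u = s'(x) + y_1 is a translation of the parameter, with slope
     1. *)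
  rewrite /partial derive_line.
  rewrite (_ : (fun t : R => _) = shift
    ('D_1 s (p 0 (lshift q 0)) + p 0 (rshift 1 i1))); last first.
    apply/funext => t; rewrite !mxE !eqxx eq_lrshift /= mulr1 mulr0 add0r.
    by rewrite addrCA.
  by have [_ ->] := dshift ('D_1 s (p 0 (lshift q 0)) + p 0 (rshift 1 i1)).
have [_ g1T g1U] := hg1; have [_ g2T g2U] := hg2.
(* In the (y_1, x) entry the right side is a multiple of a zero metric entry, whatever [lambda] and
   [rho] are; the equation becomes 1 - q = 0, against q > 1. *)
have := soliton p pW; rewrite GE => /matrixP/(_ (rshift 1 i1) (lshift q 0)).
rewrite [LHS]mxE [X in _ + X]mxE [RHS]mxE twisted_metric_rl mulr0.
rewrite (lie_derivative_twisted_metric_rl _ _ _ _ _ _ W1 W2) // mulr0 addr0.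
rewrite ricci_twisted_metric_rl //.
- rewrite ppu mulr1 => /eqP; rewrite subr_eq0 eq_sym pnatr_eq1.
  by rewrite gtn_eqF.
- by move=> z; rewrite unitmxZ ?g1U // unitfE expf_neq0 // gt_eqF // expR_gt0.
- by move=> z; rewrite linearZ /= g1T.
Qed.
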